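(* Let $n\ge 2$ and let $w_1\ge w_2\ge\dots\ge w_n\ge 0$ be arbitrary (adversarially fixed) real weights. Fix an index $k\in\{2,\dots,n\}$ and let $c_k=w_1-w_k$. Run the Secretary-with-Exact-Additive-Gap algorithm (described in the context) with gap $c=c_k$ and waiting time $\tau=1-\left(\frac{1}{k+1}\right)^{1/k}$. Then $$\mathbb{E}[\mathrm{ALG}]\ \ge\ \max\left(0.4,\ \tfrac12\left(\tfrac{1}{k+1}\right)^{1/k}\right)\cdot w_1,$$ where the expectation is over the random arrival times.
   Context: Secretary setting: $n$ elements with non-negative real weights $w_1\ge\dots\ge w_n$ fixed in advance. Element $i$ has an arrival time $t_i$, where $t_1,\dots,t_n$ are i.i.d. uniform on $[0,1]$; weight $w_i$ is revealed at time $t_i$, and at that moment the algorithm must irrevocably accept or reject it. At most one element may be accepted; $\mathrm{ALG}$ denotes the weight of the accepted element (0 if none). For $\tau\in[0,1]$, $\mathrm{BSF}(\tau)=\max_{i:t_i\le\tau}w_i$ (taken to be $0$ if no element has arrived by time $\tau$). The Secretary-with-Exact-Additive-Gap algorithm, with inputs a number $c$ and a time $\tau\in[0,1]$: observe (and reject) all elements arriving up to time $\tau$; at time $\tau$ compute $\mathrm{BSF}(\tau)$; afterwards accept the first element arriving after time $\tau$ with $w_i\ge\max(\mathrm{BSF}(\tau),c)$. The algorithm is given $k$ and the value $c_k$, but not $w_1$ or $w_k$.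
   Formalization: Among equal weights, an element counts as reaching BSF(τ) only if its index is smaller than that of every equal-weight element seen by time τ; with the literal rule the claim fails for k=2, weights 1, 1−e, e,…,e with n large. For distinct weights the rule is unchanged. *)

(* Defs.v *)
From HB Require Import structures.
From mathcomp Require Import all_boot all_order all_algebra.
From mathcomp Require Import all_classical all_reals all_analysis.

Set Implicit Arguments.
Unset Strict Implicit.
Unset Printing Implicit Defensive.

Import Order.TTheory GRing.Theory Num.Theory.

Local Open Scope classical_set_scope.
Local Open Scope ring_scope.

Section Probability.
Context {d : measure_display} {T : measurableType d} {R : realType}.
Variable P : probability T R.

(* The product rule over every finite subfamily. *)
Definition mutually_independent (I : finType) (X : I -> {RV P >-> R}) : Prop :=
  forall (J : {set I}) (B : I -> set R),
    (forall i, measurable (B i)) ->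
    P (\bigcap_(i in [set` J]) (X i @^-1` B i)) =
      (\prod_(i in J) P (X i @^-1` B i))%E.

Definition uniform01 (X : {RV P >-> R}) : Prop :=
  forall A : set R, measurable A ->
    distribution P X A = uniform_prob (@ltr01 R) A.

Definition iid_uniform01 (I : finType) (X : I -> {RV P >-> R}) : Prop :=
  mutually_independent X /\ forall i, uniform01 (X i).

End Probability.

Section Secretary.
Context {R : realType} {n : nat}.

(* Element number i + 1 is i : 'I_n; it has weight tnth w i and arrives at
   time t i. *)
Implicit Types (w : n.-tuple R) (t : 'I_n -> R) (c tau : R).

(* The initial value 0 is the convention for an empty maximum; it does not
   affect a nonempty one, since the weights are nonnegative. *)
Definition BSF w t tau : R := \big[Num.max/0]_(i < n | t i <= tau) tnth w i.

(* Weights need not be distinct, and comparisons with the best element seen so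
   far resolve equality of weights in favour of the smaller index: element i is
   not regarded as reaching the best so far if an element of the same weight
   and of smaller index was observed by time tau. For distinct weights the last
   clause is vacuous (acceptable_distinct). It cannot be dropped when ties are
   allowed: for k = 2 and weights 1, 1 - e, e, ..., e (hence c = e) the
   algorithm would, for n large, nearly always stop at one of the elements of
   weight e when both others arrive after tau, and its expected value would be
   close to tau * (1 - tau) < 1/4. *)
Definition acceptable w c tau t (i : 'I_n) : bool :=
  [&& tau < t i,
      Num.max (BSF w t tau) c <= tnth w i
    & [forall j : 'I_n,
        (t j <= tau) && (tnth w j == tnth w i) ==> (i < j)%N]].

Lemma acceptable_distinct w c tau t i : uniq w ->
  acceptable w c tau t i =
    (tau < t i) && (Num.max (BSF w t tau) c <= tnth w i).
Proof.
move=> /tuple_uniqP w_inj; rewrite /acceptable; case: ltP => //= tau_ti.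
case: (_ <= tnth w i) => //=; apply/forallP => j; apply/implyP.
by case/andP=> tj /eqP/w_inj ji; move: tj; rewrite ji leNgt tau_ti.
Qed.

(* If several acceptable elements arrive at exactly the same earliest time, an
   event of probability 0, an arbitrary one of them is taken. *)
Definition accepted w c tau t : option 'I_n :=
  [pick i | acceptable w c tau t i &&
            [forall j, acceptable w c tau t j ==> (t i <= t j)]].

Definition ALG w c tau t : R :=
  if accepted w c tau t is Some i then tnth w i else 0.

End Secretary.

(* Main.v *)
Require Import Defs.
From HB Require Import structures.
From mathcomp Require Import all_boot all_order all_algebra.
From mathcomp Require Import all_classical all_reals all_analysis.
From mathcomp Require Import measurable_realfun zify ring lra.

Set Implicit Arguments.
Unset Strict Implicit.
Unset Printing Implicit Defensive.

Import Order.TTheory GRing.Theory Num.Theory.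

Local Open Scope classical_set_scope.
Local Open Scope ring_scope.

(** Write u = w_1, v = w_k, c = u - v and q = 1 - tau, so that q^k = 1/(k+1).
    If t_1 > tau, the first element is acceptable, so the algorithm gains at
    least c; moreover an accepted element always precedes, in the order of
    weights, every element observed by time tau. Hence it gains u when
    t_2 <= tau, and at least v as soon as one of the first k+1 elements is
    observed by time tau. If u >= 2v, then c >= u/2 and the events t_1 > tau and
    t_1 > tau >= t_2 already suffice. If u <= 2v, the resulting lower bound is
    an interpolation, with weights 2(u - v) and 2v - u, between its values at
    v = u/2 and at v = u, the latter being q - q^(k+1). All numerical
    inequalities reduce to q^2 >= 1/3; only k = 2 needs a further event. *)

(** * Lower bounds on expectations by nonnegative functions of known mean *)

Section Mean.
Context {d : measure_display} {T : measurableType d} {R : realType}.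
Variable P : probability T R.

Definition has_mean (g : T -> R) (e : R) :=
  [/\ measurable_fun setT g, forall x, 0 <= g x & ('E_P[g] = e%:E)%E].

Lemma has_meanD g h e e' :
  has_mean g e -> has_mean h e' -> has_mean (g \+ h) (e + e').
Proof.
move=> [mg g0 Eg] [mh h0 Eh]; split.
- exact: measurable_funD.
- by move=> x; rewrite addr_ge0.
- rewrite EFinD -Eg -Eh unlock -ge0_integralD//.
  + by move=> x _; rewrite lee_fin.
  + exact/measurable_EFinP.
  + by move=> x _; rewrite lee_fin.
  + exact/measurable_EFinP.
Qed.

Lemma has_meanZ a g e : 0 <= a -> has_mean g e ->
  has_mean (fun x => a * g x) (a * e).
Proof.
move=> a0 [mg g0 Eg]; split.
- exact: measurable_funM.
- by move=> x; rewrite mulr_ge0.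
- rewrite EFinM -Eg unlock -ge0_integralZl_EFin//.
  + by move=> x _; rewrite lee_fin.
  + exact/measurable_EFinP.
Qed.

Lemma has_mean_pred (b : pred T) e : measurable [set x | b x] ->
  P [set x | b x] = e%:E -> has_mean (fun x => (b x)%:R) e.
Proof.
move=> mb Pb; have -> : (fun x => (b x)%:R) = \1_[set x | b x] :> (T -> R).
  by apply/funext => x; rewrite indicE; congr (nat_of_bool _)%:R;
     apply/idP/idP; rewrite inE.
by split; [exact: measurable_indic|move=> x; rewrite indicE|
           rewrite expectation_indic].
Qed.

Lemma has_mean_le g e f : has_mean g e -> (forall x, g x <= f x) ->
  (e%:E <= 'E_P[f])%E.
Proof.
move=> [mg g0 <-] gf; rewrite unlock.
(* The integral of a nonnegative f is a supremum over the simple functions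
   below f, so ALG need not be shown to be measurable. *)
have f0 x : 0 <= f x by exact: le_trans (g0 x) (gf x).
rewrite !ge0_integralTE//; try by move=> x; rewrite lee_fin.
apply: ereal_sup_le => _ [h hg <-]; exists h => // x.
by apply: le_trans (hg x) _; rewrite lee_fin.
Qed.

End Mean.

(** * Lengths of intervals under the uniform law on [0, 1] *)

Section Uniform.
Context {R : realType}.

Definition unit_length (I : interval R) : R :=
  fine (uniform_prob (@ltr01 R) [set` I]).

Lemma unit_lengthE (I : interval R) :
  uniform_prob (@ltr01 R) [set` I] = (unit_length I)%:E.
Proof. by rewrite /unit_length fineK// fin_num_measure. Qed.

Lemma unit_length_itv (I : interval R) x y (a b : R) : a <= b ->
  (forall z : R, (z \in I) && (0 <= z <= 1) =
     (z \in Interval (BSide x a) (BSide y b))) ->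
  unit_length I = b - a.
Proof.
move=> ab IE; rewrite /unit_length /uniform_prob integral_uniform_pdf.
have -> : [set` I] `&` [set` `[(0 : R), 1]%R] =
    [set` Interval (BSide x a) (BSide y b)].
  apply/seteqP; split => z /=; first by case=> zI; rewrite -IE zI in_itv.
  by rewrite -IE => /andP[zI z01]; split => //; rewrite in_itv.
rewrite (eq_integral (fun=> 1%:E)); last first.
  move=> z; rewrite inE/= -IE => /andP[_ z01].
  by rewrite /uniform_pdf z01 subr0 invr1.
(* The length formula for an interval is conditional on strict order of its ends; otherwise a = b
   and both sides vanish. *)
rewrite integral_cst//= mul1e lebesgue_measure_itv/= lte_fin.
by have [//|ba] := ltP a b; apply/esym/eqP; rewrite subr_eq0 eq_le ba ab.
Qed.

Lemma unit_length_early (a : R) : 0 <= a <= 1 -> unit_length `]-oo, a] = a.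
Proof.
move=> a01; rewrite -[RHS]subr0.
apply: (@unit_length_itv _ true false); first lra.
by move=> z; rewrite !in_itv/=; apply/idP/idP; lra.
Qed.

Lemma unit_length_late (a : R) : 0 <= a <= 1 -> unit_length `]a, +oo[ = 1 - a.
Proof.
move=> a01; apply: (@unit_length_itv _ false false); first lra.
by move=> z; rewrite !in_itv/= andbT; apply/idP/idP; lra.
Qed.

Lemma unit_length_mid (a b : R) : 0 <= a -> a <= b -> b <= 1 ->
  unit_length `]a, b] = b - a.
Proof.
move=> a0 ab b1; apply: (@unit_length_itv _ false false) => // z.
by rewrite !in_itv/=; apply/idP/idP; lra.
Qed.

End Uniform.

(** * Product events constraining the arrival times of the first few elements *)

Section Box.
Context {R : realType} {n : nat}.
Context {d : measure_display} {T : measurableType d} {P : probability T R}.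
Variable t : 'I_n -> {RV P >-> R}.
Hypothesis t_iid : iid_uniform01 t.

Definition box (s : seq (interval R)) (x : T) : bool :=
  [forall i : 'I_n, (i < size s)%N ==> (t i x \in nth `]-oo, +oo[ s i)].

Lemma boxE s : [set x | box s x] =
  \bigcap_(i in [set` [set i : 'I_n | (i < size s)%N]%SET])
     (t i @^-1` [set` nth `]-oo, +oo[ s i]).
Proof.
apply/seteqP; split => x /=.
  by move=> /forallP bx i /=; rewrite inE => iS; exact: (implyP (bx i)).
by move=> bx; apply/forallP => i; apply/implyP => iS; apply: bx; rewrite /= inE.
Qed.

Lemma measurable_box s : measurable [set x | box s x].
Proof.
rewrite boxE; apply: fin_bigcap_measurable => // i _.
exact: measurable_funPTI.
Qed.

Lemma probability_box s : (size s <= n)%N ->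
  P [set x | box s x] = (\prod_(I <- s) unit_length I)%:E.
Proof.
move=> sn; rewrite boxE.
rewrite (t_iid.1 _ (fun i : 'I_n => [set` nth `]-oo, +oo[ s i]))//.
rewrite (eq_bigr (fun i : 'I_n => (unit_length (nth `]-oo, +oo[ s i))%:E));
  last first.
  by move=> i _; rewrite -unit_lengthE; exact: (t_iid.2 i).
rewrite prodEFin; congr (_%:E).
rewrite (big_nth `]-oo, +oo[) big_mkord.
rewrite (big_ord_widen n (fun i => unit_length (nth `]-oo, +oo[ s i)) sn).
by apply: eq_bigl => i; rewrite inE.
Qed.

Lemma has_mean_box s : (size s <= n)%N ->
  has_mean P (fun x => (box s x)%:R) (\prod_(I <- s) unit_length I).
Proof.
by move=> sn; apply: has_mean_pred (measurable_box s) (probability_box sn).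
Qed.

(** Being late at t_1 while some other early index is observed is not a box, but it is a difference
    of two nested boxes. *)
Lemma has_mean_boxD s s' : (size s <= n)%N -> (size s' <= n)%N ->
  (forall x, box s' x -> box s x) ->
  has_mean P (fun x => (box s x && ~~ box s' x)%:R)
    (\prod_(I <- s) unit_length I - \prod_(I <- s') unit_length I).
Proof.
move=> sn s'n s's.
have E : [set x | box s x && ~~ box s' x] =
    [set x | box s x] `\` [set x | box s' x].
  by apply/seteqP; split => x /= => [/andP[? /negP]|[? /negP ?]]//; apply/andP.
apply: has_mean_pred; rewrite E.
  by apply: measurableD; exact: measurable_box.
rewrite measureD; [|exact: measurable_box|exact: measurable_box|].
  rewrite setIidr; last by move=> x; exact: s's.
  by rewrite EFinB; congr (_ - _)%E; exact: probability_box.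
by apply: le_lt_trans (probability_le1 _ _) (ltry 1); exact: measurable_box.
Qed.

End Box.

(** * The algorithm for fixed arrival times *)

Section Pointwise.
Context {R : realType} {n : nat} (w : n.-tuple R) (c tau : R) (t : 'I_n -> R).
Hypothesis w_sorted : forall i j : 'I_n, (i <= j)%N -> tnth w j <= tnth w i.
Hypothesis w_ge0 : forall i : 'I_n, 0 <= tnth w i.

(** If [j <= i], then w_i <= w_j by sorting and w_j <= BSF <= w_i by acceptance, so the weights tie;
    the tie rule then demands [i < j], a contradiction. *)
Lemma acceptable_ltn (i j : 'I_n) :
  acceptable w c tau t i -> t j <= tau -> (i < j)%N.
Proof.
case/and3P => _ + /forallP/(_ j) tie tj; rewrite ge_max => /andP[bsf_i _].
rewrite ltnNge; apply/negP => ji; move: tie; rewrite tj/=.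
suff -> : tnth w j == tnth w i by rewrite ltnNge ji.
rewrite eq_le [X in _ && X]w_sorted// andbT; apply: le_trans bsf_i.
exact: le_bigmax_cond.
Qed.

Lemma acceptable_ord0 (i0 : 'I_n) : i0 = 0%N :> nat -> c <= tnth w i0 ->
  tau < t i0 -> acceptable w c tau t i0.
Proof.
move=> i00 cw ti0; rewrite /acceptable ti0 ge_max cw andbT /=.
apply/andP; split.
  by rewrite /BSF; apply: bigmax_le => // i _; apply: w_sorted; rewrite i00.
apply/forallP => j; apply/implyP => /andP[tj _]; rewrite i00 lt0n.
apply: contraTneq tj => j0; rewrite -ltNge (_ : j = i0)//.
by apply: val_inj; rewrite /= i00.
Qed.

Lemma ALG_ge0 : 0 <= ALG w c tau t.
Proof. by rewrite /ALG; case: accepted. Qed.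

Lemma ALG_late (i0 : 'I_n) : i0 = 0%N :> nat -> c <= tnth w i0 ->
    tau < t i0 ->
  exists i, [/\ ALG w c tau t = tnth w i, c <= tnth w i, t i <= t i0 &
    forall j, t j <= tau -> (i < j)%N].
Proof.
move=> i00 cw /(acceptable_ord0 i00 cw) acc0; rewrite /ALG /accepted.
case: pickP => [i /andP[acc_i /forallP min_i]|no_min].
  exists i; split => //; last by move=> j; exact: acceptable_ltn.
    by case/and3P: acc_i => _; rewrite ge_max => /andP[].
  exact: implyP (min_i i0) acc0.
(* The first element is acceptable, so the finite set of acceptable elements has an earliest arrival
   and the [pick] cannot fail. *)
case: (arg_minP t acc0) => i acc_i min_i.
have := no_min i; rewrite acc_i/= => /negP; case.
by apply/forallP => j; apply/implyP => /min_i.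
Qed.

End Pointwise.

(** * Numerical bounds for q = (k+1)^(-1/k) *)

Section Estimates.
Context {R : realType}.
Implicit Types (q u v m : R) (k : nat).

(** This is q^2 >= 1/3 raised to the power k, with equality at k = 2. *)
Lemma sqr_succ_leq_expn3 k : (2 <= k)%N -> (k.+1 ^ 2 <= 3 ^ k)%N.
Proof.
elim: k => // -[|[|k]] IH // _; have {}IH := IH isT.
by rewrite (expnS 3); apply: leq_trans (leq_mul (leqnn 3) IH); nia.
Qed.

Lemma root_succ_expr k : (2 <= k)%N ->
  ((k.+1%:R^-1) `^ (k%:R^-1) : R) ^+ k = k.+1%:R^-1.
Proof.
move=> k2; rewrite -powR_mulrn ?powR_ge0// -powRrM mulVf ?powRr1//.
by rewrite pnatr_eq0; case: k k2.
Qed.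

Lemma root_succ_bounds k (q := (k.+1%:R^-1) `^ (k%:R^-1) : R) : (2 <= k)%N ->
  [/\ q < 1, 577 / 1000 <= q & 0 <= q].
Proof.
move=> k2; have qk := root_succ_expr k2; rewrite -/q in qk.
have q0 : 0 <= q by exact: powR_ge0.
split => //.
  rewrite ltNge; apply/negP => q1; have := exprn_ege1 k q1.
  by rewrite qk invf_ge1// lern1; case: k k2 {q qk q0 q1}.
(* The constant 577/1000 lies just below the square root of 1/3. *)
suff : 3^-1 <= q ^+ 2 by rewrite expr2; nra.
rewrite leNgt; apply/negP => q3.
have : (q ^+ 2) ^+ k < (3^-1) ^+ k.
  by rewrite ltrXn2r// ?exprn_ge0//; case: k k2 {q qk q0 q3}.
rewrite exprAC qk !exprVn ltf_pV2 ?posrE ?exprn_gt0//.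
by rewrite -!natrX ltr_nat ltnNge sqr_succ_leq_expn3.
Qed.

(** The two weights are nonnegative and sum to [u]. *)
Lemma interpolate_ge m u v e1 e2 : m <= e1 -> m <= e2 -> u <= 2 * v -> v <= u ->
  m * u <= 2 * (u - v) * e1 + (2 * v - u) * e2.
Proof.
move=> me1 me2 uv vu.
have := ler_wpM2l (_ : 0 <= 2 * (u - v)) me1.
have := ler_wpM2l (_ : 0 <= 2 * v - u) me2.
by move=> /(_ ltac:(lra)) ? /(_ ltac:(lra)); lra.
Qed.

End Estimates.

(** * Expected gain with gap [u - v], case by case *)

Section Gap.
Context {R : realType} {n : nat} (w : n.-tuple R) (k : nat) (tau : R).
Context {d : measure_display} {T : measurableType d} {P : probability T R}.
Variables (t : 'I_n -> {RV P >-> R}) (i0 i1 ik : 'I_n).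
Hypothesis w_sorted : forall i j : 'I_n, (i <= j)%N -> tnth w j <= tnth w i.
Hypothesis w_ge0 : forall i : 'I_n, 0 <= tnth w i.
Hypothesis t_iid : iid_uniform01 t.
Hypotheses (i0E : i0 = 0%N :> nat) (i1E : i1 = 1%N :> nat)
  (ikE : ik = k.-1 :> nat) (k_gt1 : (1 < k)%N).
Hypothesis tau01 : 0 <= tau <= 1.

Let u := tnth w i0.
Let v := tnth w ik.
Let q : R := 1 - tau.
Let alg (x : T) := ALG w (u - v) tau (fun i => t i x).
Let late : interval R := `]tau, +oo[.
Let early : interval R := `]-oo, tau].

Let n_gt1 : (1 < n)%N. Proof. by rewrite -i1E ltn_ord. Qed.

Let u_ge0 : 0 <= u. Proof. exact: w_ge0. Qed.

Let v_ge0 : 0 <= v. Proof. exact: w_ge0. Qed.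

Let v_le_u : v <= u. Proof. by apply: w_sorted; rewrite i0E. Qed.

Let alg_ge0 x : 0 <= alg x. Proof. exact: ALG_ge0. Qed.

Let v_le_w (i : 'I_n) : (i < k)%N -> v <= tnth w i.
Proof. by move=> ik'; apply: w_sorted; rewrite ikE; case: k k_gt1 ik'. Qed.

Let alg_late x : tau < t i0 x ->
  exists i, [/\ alg x = tnth w i, u - v <= tnth w i, t i x <= t i0 x &
    forall j, t j x <= tau -> (i < j)%N].
Proof. by apply: ALG_late => //; rewrite gerBl. Qed.

Let alg_ge_gap x : tau < t i0 x -> u - v <= alg x.
Proof. by case/alg_late => i [-> ? _ _]. Qed.

Let alg_ge_best x : tau < t i0 x -> t i1 x <= tau -> u <= alg x.
Proof.
case/alg_late => i [-> _ _ lt_i] /lt_i; rewrite i1E ltnS leqn0 => /eqP i_0.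
by apply: w_sorted; rewrite i_0.
Qed.

(** Indices start at 0, so [j <= k] covers k + 1 elements: the accepted index is strictly below [j],
    hence among the first k. *)
Let alg_ge_kth x (j : 'I_n) : tau < t i0 x -> (j <= k)%N ->
  t j x <= tau -> v <= alg x.
Proof.
by case/alg_late => i [-> _ _ lt_i] jk /lt_i ij; apply/v_le_w/(leq_trans ij).
Qed.

Lemma box_late x : box t [:: late] x = (tau < t i0 x).
Proof.
apply/forallP/idP => [/(_ i0)|ti0 j]; first by rewrite i0E /= in_itv /= andbT.
apply/implyP; rewrite ltnS leqn0 => /eqP j0.
by rewrite j0 /= in_itv/= andbT (_ : j = i0)//; apply: val_inj; rewrite /= j0.
Qed.

Lemma box_late_early x :
  box t [:: late; early] x = (tau < t i0 x) && (t i1 x <= tau).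
Proof.
apply/forallP/andP => [b|[ti0 ti1] j].
  have := b i0; have := b i1; rewrite i0E i1E /= !in_itv /= andbT.
  by move=> -> ->.
apply/implyP; case jE: (nat_of_ord j) => [|[|//]] _ /=; rewrite in_itv/=.
  by rewrite andbT (_ : j = i0)//; apply: val_inj; rewrite /= jE.
by rewrite (_ : j = i1)//; apply: val_inj; rewrite /= jE.
Qed.

Lemma box_nth s x (j : 'I_n) : box t s x -> (j < size s)%N ->
  t j x \in nth `]-oo, +oo[ s j.
Proof. by move=> /forallP/(_ j)/implyP. Qed.

Lemma box_nseq_late m x : reflect (forall j : 'I_n, (j < m)%N -> tau < t j x)
  (box t (nseq m late) x).
Proof.
apply: (iffP forallP) => b j; have := b j; rewrite size_nseq nth_nseq.
  by move=> + jm; rewrite jm in_itv/= andbT.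
by move=> tj; apply/implyP => jm; rewrite jm in_itv/= andbT tj.
Qed.

Let mean_late : has_mean P (fun x => (tau < t i0 x)%R%:R) q.
Proof.
have := has_mean_box t_iid (s := [:: late]) (ltnW n_gt1).
rewrite big_seq1 unit_length_late//.
by under eq_fun => x do rewrite box_late.
Qed.

Let mean_late_early :
  has_mean P (fun x => ((tau < t i0 x)%R && (t i1 x <= tau)%R)%:R)
    (q * (1 - q)).
Proof.
have := has_mean_box t_iid (s := [:: late; early]) n_gt1.
rewrite big_cons big_seq1 unit_length_late// unit_length_early// subKr.
by under eq_fun => x do rewrite box_late_early.
Qed.

(** Here the gap is at least u/2, which is gained whenever t_1 is late; an early t_2 adds another
    u/2. *)
Lemma expectation_small_kth : 2 * v <= u ->
  (((q / 2 + q * (1 - q) / 2) * u)%:E <= 'E_P[alg])%E.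
Proof.
move=> vu; have u2 : 0 <= u / 2 by rewrite divr_ge0.
have -> : (q / 2 + q * (1 - q) / 2) * u = u / 2 * q + u / 2 * (q * (1 - q)).
  by field.
apply: has_mean_le (has_meanD (has_meanZ u2 mean_late)
  (has_meanZ u2 mean_late_early)) _ => x /=.
have [ti0|_] := boolP (tau < t i0 x); last first.
  by rewrite /= !mulr0 addr0.
have := alg_ge_gap ti0; have := alg_ge_best ti0.
by case: (t i1 x <= tau) => [/(_ isT)|_] /=; lra.
Qed.

(** When k = n, [v] is the least weight, so any accepted element yields at least [v]. *)
Lemma expectation_last : k = n ->
  ((v * q + (u - v) * (q * (1 - q)))%:E <= 'E_P[alg])%E.
Proof.
move=> kn; have uv : 0 <= u - v by rewrite subr_ge0.
apply: has_mean_le (has_meanD (has_meanZ v_ge0 mean_late)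
  (has_meanZ uv mean_late_early)) _ => x /=.
have [ti0|_] := boolP (tau < t i0 x); last first.
  by rewrite /= !mulr0 addr0.
have : v <= alg x by have [i [-> _ _ _]] := alg_late ti0; rewrite v_le_w// kn.
have := alg_ge_best ti0.
by case: (t i1 x <= tau) => [/(_ isT)|_] /=; lra.
Qed.

Let mean_observed : (k < n)%N -> has_mean P
  (fun x => ((tau < t i0 x)%R && ~~ box t (nseq k.+1 late) x)%:R)
  (q - q ^+ k.+1).
Proof.
move=> kn; have sub x : box t (nseq k.+1 late) x -> box t [:: late] x.
  by rewrite box_late => /box_nseq_late/(_ i0); rewrite i0E; exact.
have := has_mean_boxD t_iid (s := [:: late]) (ltnW n_gt1) _ sub.
rewrite size_nseq => /(_ kn).
rewrite big_seq1 big_nseq unit_length_late// -/q.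
rewrite (_ : iter _ _ _ = q ^+ k.+1);
  last by elim: k.+1 => //= m ->; rewrite exprS.
by under eq_fun => x do rewrite box_late.
Qed.

(** The gain has three levels: [u - v] always, [v] once one of the first k + 1 elements is observed,
    [u] once the second is. The coefficients are the successive increments. *)
Let alg_ge_sum x : u <= 2 * v -> tau < t i0 x ->
  (u - v) + (2 * v - u) * (~~ box t (nseq k.+1 late) x)%:R +
    (u - v) * (t i1 x <= tau)%R%:R <= alg x.
Proof.
move=> uv ti0; have := alg_ge_gap ti0; have := alg_ge_best ti0.
have : ~~ box t (nseq k.+1 late) x -> v <= alg x.
  move=> /box_nseq_late nall; apply: contrapT => nv; apply: nall => j jk.
  by rewrite ltNge; apply/negP => /(alg_ge_kth ti0 jk).
have : t i1 x <= tau -> ~~ box t (nseq k.+1 late) x.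
  move=> ti1; apply/negP => /box_nseq_late/(_ i1).
  by rewrite i1E ltnS (ltnW k_gt1) => /(_ isT); rewrite ltNge ti1.
case: (t i1 x <= tau) => [/(_ isT) ->/= /(_ isT) _ /(_ isT)|_] /=; first by lra.
by case: (~~ _) => [/(_ isT) v_le|_] _ /=; lra.
Qed.

Lemma expectation_large_kth : (k < n)%N -> u <= 2 * v ->
  (((u - v) * q + (2 * v - u) * (q - q ^+ k.+1) + (u - v) * (q * (1 - q)))%:E
    <= 'E_P[alg])%E.
Proof.
move=> kn uv; have uv' : 0 <= u - v by rewrite subr_ge0.
have uv2 : 0 <= 2 * v - u by lra.
apply: has_mean_le (has_meanD (has_meanD (has_meanZ uv' mean_late)
  (has_meanZ uv2 (mean_observed kn)))
  (has_meanZ uv' mean_late_early)) _ => x /=.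
have [/(alg_ge_sum uv)|_] := boolP (tau < t i0 x); rewrite /=; first by lra.
by have := alg_ge0 x; lra.
Qed.

(* For k = 2 the event that no index up to k is observed by time tau must also
   contribute: on the box below, where the midpoint of [tau, 1] separates t_1
   from t_3, the third element is not the first to arrive. *)
Let mid : R := 1 - q / 2.
Let split_box : seq (interval R) :=
  [:: `]tau, mid]; late; `]mid, +oo[] ++
  (if (3 < n)%N then [:: early] else [::]).

(** The first three intervals have lengths q/2, q, q/2. The factor 1 - q comes from the fourth
    element and is absent when n = 3, hence an inequality. *)
Let mean_split : (2 < n)%N -> exists2 e, q ^+ 3 / 4 * (1 - q) <= e &
  has_mean P (fun x => (box t split_box x)%:R) e.
Proof.
move=> n2; exists (\prod_(I <- split_box) unit_length I); last first.
  by apply: has_mean_box => //; rewrite size_cat; case: ifP.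
have /andP[tau0 tau1] := tau01; have q01 : 0 <= q <= 1 by rewrite /q; lra.
have q3 : 0 <= q ^+ 3 by apply: exprn_ge0; case/andP: q01.
rewrite big_cat !big_cons big_nil unit_length_mid; try by rewrite /mid /q; lra.
rewrite !unit_length_late; try by rewrite /mid /q; lra.
rewrite (_ : mid - tau = q / 2); last by rewrite /mid /q; field.
rewrite (_ : 1 - mid = q / 2); last by rewrite /mid; ring.
rewrite /= -/q mulr1 (_ : q / 2 * _ = q ^+ 3 / 4); last by field.
case: ifP => _; last by rewrite big_nil; nra.
by rewrite big_seq1 unit_length_early// (_ : tau = 1 - q)// /q; ring.
Qed.

Lemma expectation_large_second : k = 2%N -> (2 < n)%N -> u <= 2 * v ->
  (((u - v) * q +
    (2 * v - u) * (q - q ^+ 3 + q ^+ 3 / 4 * (1 - q)) +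
    (u - v) * (q * (1 - q)))%:E <= 'E_P[alg])%E.
Proof.
move=> k2 n2 uv; have uv' : 0 <= u - v by rewrite subr_ge0.
have uv2 : 0 <= 2 * v - u by lra.
have [e qe mean_e] := mean_split n2.
have kn : (k < n)%N by rewrite k2.
have M := has_meanD (has_meanD (has_meanD (has_meanZ uv' mean_late)
  (has_meanZ uv2 (mean_observed kn))) (has_meanZ uv' mean_late_early))
  (has_meanZ uv2 mean_e).
apply: (le_trans _ (has_mean_le M _)) => [|x /=].
  by rewrite lee_fin k2; have := ler_wpM2l uv2 qe; lra.
have [i2 i2E] : exists i : 'I_n, i = 2%N :> nat by exists (Ordinal n2).
have [bx|_] := boolP (box t split_box x); last first.
  have [/(alg_ge_sum uv)|_] := boolP (tau < t i0 x); rewrite /=; first by lra.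
  by have := alg_ge0 x; lra.
have size_split : (2 < size split_box)%N by rewrite size_cat.
have := box_nth (j := i0) bx; rewrite i0E => /(_ (ltnW (ltnW size_split))).
have := box_nth (j := i1) bx; rewrite i1E => /(_ (ltnW size_split)).
have := box_nth (j := i2) bx; rewrite i2E => /(_ size_split).
rewrite /= !in_itv /= !andbT => ti2 ti1 /andP[ti0 ti0'].
have midtau : tau <= mid by exact: ltW (lt_le_trans ti0 ti0').
rewrite ti0 /= [t i1 x <= tau]leNgt ti1 /=.
(* On the split box the first three elements are all late, so the sum only accounts for [u - v]; the
   extra [2 * v - u] amounts to a gain of [v]. *)
have -> : box t (nseq k.+1 late) x.
  apply/box_nseq_late => j; rewrite k2.
  case jE: (nat_of_ord j) => [|[|[|//]]] _.
  - by rewrite (_ : j = i0)//; apply: val_inj; rewrite /= jE.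
  - by rewrite (_ : j = i1)//; apply: val_inj; rewrite /= jE.
  - rewrite (_ : j = i2); last by apply: val_inj; rewrite /= jE.
    exact: le_lt_trans ti2.
suff : v <= alg x by rewrite /=; lra.
have [i [-> _ ii0 lt_i]] := alg_late ti0; apply: v_le_w; rewrite k2.
(* The accepted element arrives no later than the first, thus by [mid], whereas the third arrives
   after [mid]. *)
have i_neq2 : i != 2%N :> nat.
  apply: contraTneq ii0 => i_2; rewrite -ltNge (_ : i = i2).
    exact: le_lt_trans ti2.
  by apply: val_inj; rewrite /= i_2.
rewrite ltn_neqAle i_neq2 -ltnS /=.
(* An index at most 2 is forced by the observed fourth element, or by n = 3. *)
have [n3|n3] := ltnP 3 n; last by apply: leq_trans n3.
apply: (lt_i (Ordinal n3)).
by have := box_nth (j := Ordinal n3) bx; rewrite /split_box n3 /= in_itv; apply.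
Qed.

End Gap.

(** * Assembling the cases at the prescribed waiting time *)

Theorem mainTheorem1 (R : realType) (n : nat) (hn : (2 <= n)%N)
    (w : n.-tuple R)
    (w_sorted : forall i j : 'I_n, (i <= j)%N -> tnth w j <= tnth w i)
    (w_ge0 : forall i : 'I_n, 0 <= tnth w i)
    (k : nat) (hk : (2 <= k <= n)%N)
    (d : measure_display) (T : measurableType d) (P : probability T R)
    (t : 'I_n -> {RV P >-> R}) (t_iid : iid_uniform01 t) :
  let w1 := w`_0 in
  let c := w1 - w`_k.-1 in
  let q : R := (k.+1%:R^-1) `^ (k%:R^-1) in
  let tau := 1 - q in
  ((Num.max (4 / 10) (2^-1 * q) * w1)%:E
     <= 'E_P[fun x : T => ALG w c tau (fun i => t i x)])%E.
Proof.
cbv zeta; set w1 := w`_0; set c := w1 - _.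
set q : R := _ `^ _; set tau : R := 1 - q.
have [k2 kn] := andP hk.
have k1n : (k.-1 < n)%N by rewrite prednK// ltnW.
have [q_lt1 q_ge q_ge0] := @root_succ_bounds R k k2.
rewrite -/q in q_lt1 q_ge q_ge0.
have qk := @root_succ_expr R k k2; rewrite -/q in qk.
pose i0 : 'I_n := Ordinal (ltnW hn).
pose i1 : 'I_n := Ordinal hn.
pose ik : 'I_n := Ordinal k1n.
have i0E : i0 = 0%N :> nat by [].
have i1E : i1 = 1%N :> nat by [].
have ikE : ik = k.-1 :> nat by [].
have uE : w1 = tnth w i0 by rewrite (tnth_nth 0).
have vE : w`_k.-1 = tnth w ik by rewrite (tnth_nth 0).
have tau01 : 0 <= tau <= 1 by rewrite /tau; lra.
have qE : 1 - tau = q by rewrite subKr.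
have u_ge0 := w_ge0 i0.
have v_le_u : tnth w ik <= tnth w i0 by exact: w_sorted.
rewrite /c uE vE; set u := tnth w i0 in u_ge0 v_le_u *.
set v := tnth w ik in v_le_u *.
(* The endpoint v = u/2 of the interpolation, shared by all cases with u < 2v; it also settles u >=
   2v. *)
have half_ge : Num.max (4 / 10) (2^-1 * q) <= q / 2 + q * (1 - q) / 2.
  by rewrite ge_max; apply/andP; split; nra.
have [vu|uv] := leP (2 * v) u.
  apply: le_trans (expectation_small_kth w_sorted w_ge0 t_iid i0E i1E tau01 vu).
  by rewrite qE lee_fin ler_wpM2r.
have [kn'|kn'] := eqVneq k n.
  apply: le_trans (expectation_last w_sorted w_ge0 t_iid i0E i1E ikE k2 tau01
    kn').
  have q_max : Num.max (4 / 10) (2^-1 * q) <= q by rewrite ge_max; lra.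
  rewrite qE lee_fin; have := interpolate_ge half_ge q_max (ltW uv) v_le_u.
  by move=> /le_trans; apply; rewrite -/u -/v; lra.
have {kn'} kn' : (k < n)%N by rewrite ltn_neqAle kn'.
have qSk : q ^+ k.+1 = q / k.+1%:R by rewrite exprS qk.
have [k_eq2|k_neq2] := eqVneq k 2%N.
  have n_gt2 : (2 < n)%N by rewrite -k_eq2.
  apply: le_trans (expectation_large_second w_sorted w_ge0 t_iid i0E i1E ikE
    k2 tau01 k_eq2 n_gt2 (ltW uv)).
  have q3 : q ^+ 3 = q / 3 by have := qSk; rewrite k_eq2.
  have q_le : q <= 578 / 1000.
    by have := qk; rewrite k_eq2 expr2; nra.
  rewrite qE q3 lee_fin.
  (* For k = 2, q - q/3 is only about 0.385; the split box adds about 0.02 and lifts the endpoint v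
     = u above 0.4. *)
  have full_ge : Num.max (4 / 10) (2^-1 * q) <= q - q / 3 + q / 3 / 4 * (1 - q).
    by rewrite ge_max; apply/andP; split; nra.
  have := interpolate_ge half_ge full_ge (ltW uv) v_le_u.
  by move=> /le_trans; apply; rewrite -/u -/v; lra.
have k3 : (3 <= k)%N by rewrite ltn_neqAle eq_sym k_neq2.
apply: le_trans (expectation_large_kth w_sorted w_ge0 t_iid i0E i1E ikE k2
  tau01 kn' (ltW uv)).
(* From k = 3 on, the endpoint v = u is at least 3q/4, which exceeds 0.4. *)
have qSk_le : q ^+ k.+1 <= q / 4.
  rewrite qSk; apply: ler_wpM2l => //.
  by rewrite lef_pV2 ?posrE// ler_nat.
rewrite qE lee_fin.
have full_ge : Num.max (4 / 10) (2^-1 * q) <= q - q ^+ k.+1.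
  by rewrite ge_max; lra.
have := interpolate_ge half_ge full_ge (ltW uv) v_le_u.
by move=> /le_trans; apply; rewrite -/u -/v; lra.
Qed.
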